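(* Consider the two-stage linear model $y=X\beta+u$, $X=D+V$, $D=ZA$. Let $\hat D=Z\hat A$ be a prediction of the conditional mean matrix $D$ from an estimate $\hat A$ of the first-stage regression matrix $A$. Let $\hat\beta$ be a second-stage estimator of $\beta$ based on the predictions $\hat D$, and let $\hat\Theta$ denote an estimator of $\Theta=\mathbb E[d_id_i^\top]^{-1}$. The one-step second-stage estimator $$\tilde\beta=\hat\beta+\hat\Theta\hat D^\top(y-X\hat\beta)/n$$ satisfies $\sqrt n(\tilde\beta-\beta)=\Theta D^\top u/\sqrt n+\sum_{\ell=1}^4 f_\ell$, where $$f_1=(\hat\Theta-\Theta)D^\top u/\sqrt n,\qquad f_2=\hat\Theta(\hat D-D)^\top u/\sqrt n,$$ $$f_3=\hat\Theta\hat D^\top(X-\hat D)(\beta-\hat\beta)/\sqrt n,\qquad f_4=\sqrt n(\hat\Theta\hat\Sigma_d-I)(\beta-\hat\beta).$$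
   Context: Model: for $i=1,\dots,n$, $y_i=x_i^\top\beta+u_i$ and $x_{ij}=z_i^\top\alpha^j+v_{ij}$, $j=1,\dots,p_x$, with $x_i,\beta\in\mathbb R^{p_x}$, $z_i,\alpha^j\in\mathbb R^{p_z}$, $\mathbb E[u_i\mid z_i]=0$, $\mathbb E[v_i\mid z_i]=0$ for $v_i=(v_{i1},\dots,v_{ip_x})^\top$. The matrices $X,D,V\in\mathbb R^{n\times p_x}$ have rows $x_i$, $d_i=\mathbb E[x_i\mid z_i]=A^\top z_i$ and $v_i$; $Z\in\mathbb R^{n\times p_z}$ has rows $z_i$; $A\in\mathbb R^{p_z\times p_x}$ has columns $\alpha^j$; $y=(y_i)$, $u=(u_i)$. $\mathbb E[d_id_i^\top]$ is invertible and does not depend on $i$. $\hat\Sigma_d:=\hat D^\top\hat D/n$. The estimators $\hat A\in\mathbb R^{p_z\times p_x}$, $\hat\beta\in\mathbb R^{p_x}$, $\hat\Theta\in\mathbb R^{p_x\times p_x}$ are otherwise arbitrary. *)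

(* Defs.v *)
From HB Require Import structures.
From mathcomp Require Import all_boot all_order all_algebra.
From mathcomp Require Import all_classical all_reals all_analysis.

Set Implicit Arguments.
Unset Strict Implicit.
Unset Printing Implicit Defensive.

Import Order.TTheory GRing.Theory Num.Theory.
Import numFieldNormedType.Exports.

Local Open Scope classical_set_scope.
Local Open Scope ring_scope.

(* [is_cond_exp P G Y W]: W is a version of the conditional expectation of Y
   given the sigma-algebra G, assumed to be contained in that of Omega. *)
Definition is_cond_exp (R : realType) (d : measure_display)
    (Omega : measurableType d) (P : probability Omega R)
    (G : set (set Omega)) (Y W : Omega -> R) : Prop :=
  [/\ P.-integrable setT (EFin \o Y),
      P.-integrable setT (EFin \o W),
      forall B : set R, measurable B -> G (W @^-1` B)
    & forall E : set Omega, G E ->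
        (\int[P]_(w in E) (Y w)%:E = \int[P]_(w in E) (W w)%:E)%E].

(* The sigma-algebra generated by the random vector z_i, the i-th row of Z. *)
Definition sigma_row (R : realType) (Omega : Type) (n p : nat)
    (Z : Omega -> 'M[R]_(n, p)) (i : 'I_n) : set (set Omega) :=
  g_sigma_preimage (fun (k : 'I_p) (w : Omega) => Z w i k).

Record two_stage_model (R : realType) (d : measure_display)
    (Omega : measurableType d) (P : probability Omega R) (n px pz : nat)
    (y : Omega -> 'cV[R]_n) (X : Omega -> 'M[R]_(n, px))
    (Z : Omega -> 'M[R]_(n, pz)) (D V : Omega -> 'M[R]_(n, px))
    (u : Omega -> 'cV[R]_n) (beta : 'cV[R]_px) (A : 'M[R]_(pz, px)) : Prop :=
  TwoStageModel {
    measurable_Z : forall i k, measurable_fun setT (fun w => Z w i k);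
    second_stage : forall w, y w = X w *m beta + u w;
    first_stage : forall w, X w = D w + V w;
    cond_mean_linear : forall w, D w = Z w *m A;
    cond_mean_X : forall i j,
      is_cond_exp P (sigma_row Z i) (fun w => X w i j) (fun w => D w i j);
    cond_mean_u : forall i,
      is_cond_exp P (sigma_row Z i) (fun w => u w i 0) (cst 0);
    cond_mean_V : forall i j,
      is_cond_exp P (sigma_row Z i) (fun w => V w i j) (cst 0)
  }.

(* E[d_i d_i^T] = S, where d_i is the i-th row of D. As S has real entries,
   this includes the finiteness of the expectations. *)
Definition row_second_moment (R : realType) (d : measure_display)
    (Omega : measurableType d) (P : probability Omega R) (n p : nat)
    (D : Omega -> 'M[R]_(n, p)) (i : 'I_n) (S : 'M[R]_p) : Prop :=
  forall j k, ('E_P[fun w => (D w i j * D w i k)%R] = (S j k)%:E)%E.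

Definition one_step (R : realType) (n p : nat) (Dhat X : 'M[R]_(n, p))
    (y : 'cV[R]_n) (betahat : 'cV[R]_p) (Thetahat : 'M[R]_p) : 'cV[R]_p :=
  betahat + n%:R^-1 *: (Thetahat *m Dhat^T *m (y - X *m betahat)).

(* Main.v *)
Require Import Defs.
From HB Require Import structures.
From mathcomp Require Import all_boot all_order all_algebra.
From mathcomp Require Import all_classical all_reals all_analysis.

Set Implicit Arguments.
Unset Strict Implicit.
Unset Printing Implicit Defensive.

Import Order.TTheory GRing.Theory Num.Theory.
Import numFieldNormedType.Exports.

Local Open Scope ring_scope.

(** The identity is exact algebra at a fixed outcome. With [delta = beta - betahat], the residual is
    [X *m delta + u], so the one-step error is [Thetahat *m Dhat^T] applied to it, divided by [n],
    minus [delta]. Splitting [X] as [(X - Dhat) + Dhat] gives [f3] from the first summand, while the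
    second joins [- delta] to form [f4]; this is [sqrt_one_step_error]. The noise term left over has
    the estimated weight [Thetahat *m Dhat^T]; passing to [Theta *m D^T] one factor at a time leaves
    [f2] and [f1]. *)

Lemma sqrt_one_step_error (R : realType) (n p : nat) (Dhat X : 'M[R]_(n, p))
    (u : 'cV[R]_n) (beta betahat : 'cV[R]_p) (Thetahat : 'M[R]_p) :
  (0 < n)%N ->
  Num.sqrt n%:R *:
    (one_step Dhat X (X *m beta + u) betahat Thetahat - beta)
  = (Num.sqrt n%:R)^-1 *: (Thetahat *m Dhat^T *m u)
    + (Num.sqrt n%:R)^-1 *:
        (Thetahat *m Dhat^T *m (X - Dhat) *m (beta - betahat))
    + Num.sqrt n%:R *: ((Thetahat *m (n%:R^-1 *: (Dhat^T *m Dhat)) - 1%:M)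
        *m (beta - betahat)).
Proof.
move=> n_gt0; set s : R := Num.sqrt n%:R.
have s_neq0 : s != 0 by rewrite gt_eqF // sqrtr_gt0 ltr0n.
have sVn : s * n%:R^-1 = s^-1.
  by rewrite -[n%:R in LHS]sqr_sqrtr ?ler0n // -/s expr2 invfM mulVKf.
have residualE : X *m beta + u - X *m betahat = X *m (beta - betahat) + u.
  by rewrite mulmxBr addrAC.
have -> : one_step Dhat X (X *m beta + u) betahat Thetahat - beta
    = n%:R^-1 *: (Thetahat *m Dhat^T *m (X *m (beta - betahat) + u))
      - (beta - betahat).
  by rewrite /one_step residualE addrAC [RHS]addrC opprB.
(* The error is made atomic so that the distributivity rewrites below do not split it. *)
move: (beta - betahat) => delta.
rewrite scalerBr scalerA sVn mulmxDr scalerDr mulmxBr !mulmxBl mul1mx.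
rewrite -!scalemxAr -!scalemxAl !scalerBr scalerA sVn !mulmxA.
(* On the right, the [Dhat^T *m Dhat] products from the [X - Dhat] term and from the Gram term now
   both carry the factor [s^-1] and cancel. *)
by rewrite !addrA addrNK; congr (_ - _); apply: addrC.
Qed.

Theorem lemma3p1 (R : realType) (d : measure_display)
    (Omega : measurableType d) (P : probability Omega R) (n px pz : nat)
    (y : Omega -> 'cV[R]_n) (X : Omega -> 'M[R]_(n, px))
    (Z : Omega -> 'M[R]_(n, pz)) (D V : Omega -> 'M[R]_(n, px))
    (u : Omega -> 'cV[R]_n) (beta : 'cV[R]_px) (A : 'M[R]_(pz, px))
    (Sigma_d : 'M[R]_px)
    (Ahat : Omega -> 'M[R]_(pz, px)) (betahat : Omega -> 'cV[R]_px)
    (Thetahat : Omega -> 'M[R]_px)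
    (n_gt0 : (0 < n)%N)
    (model : two_stage_model P y X Z D V u beta A)
    (Sigma_dE : forall i : 'I_n, row_second_moment P D i Sigma_d)
    (Sigma_d_unit : Sigma_d \in unitmx)
    (w : Omega) :
  let Theta := invmx Sigma_d in
  let sqrtn : R := Num.sqrt n%:R in
  let Dhat := Z w *m Ahat w in
  let Sigmahat_d := n%:R^-1 *: (Dhat^T *m Dhat) in
  let betatilde := one_step Dhat (X w) (y w) (betahat w) (Thetahat w) in
  let f1 := sqrtn^-1 *: ((Thetahat w - Theta) *m (D w)^T *m u w) in
  let f2 := sqrtn^-1 *: (Thetahat w *m (Dhat - D w)^T *m u w) in
  let f3 := sqrtn^-1 *:
    (Thetahat w *m Dhat^T *m (X w - Dhat) *m (beta - betahat w)) in
  let f4 := sqrtn *: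
    ((Thetahat w *m Sigmahat_d - 1%:M) *m (beta - betahat w)) in
  sqrtn *: (betatilde - beta)
  = sqrtn^-1 *: (Theta *m (D w)^T *m u w) + (f1 + f2 + f3 + f4).
Proof.
move=> Theta sqrtn Dhat Sigmahat_d betatilde f1 f2 f3 f4.
rewrite /betatilde (second_stage model) sqrt_one_step_error // !addrA.
(* [f3] and [f4] match on both sides; what remains is the noise term against the leading term plus
   [f1] and [f2]. *)
congr (_ + _ + _); rewrite -!scalerDr; congr (_ *: _).
(* Telescoping: [Theta] and [Thetahat - Theta] share the factor [(D w)^T]; then [D w] and
   [Dhat - D w] share [Thetahat w]. *)
by rewrite -!mulmxDl subrKC -mulmxDr -linearD /= subrKC.
Qed.
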